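(* Let $d\geq 1$, $n\geq 1$ and $k\geq 0$ be integers. Then the following hold. (i) For every integer $j$ with $0\leq j\leq d$, $$\mathbf{A}_{d+1,k,d-j+1}=\sum_{i=0}^{k}\binom{d+1}{i}(-1)^i(k-i)^j(k-i+1)^{d-j}.$$ (ii) $$D(d,n,k)=\sum_{i=0}^{k}\binom{d+1}{i}(-1)^i\bigl(n(k-i)+1\bigr)^d.$$
   Context: Convention: $0^0=1$, and $\binom{d+1}{i}=0$ for $i>d+1$. $S_d$ denotes the symmetric group on $\{1,\dots,d\}$, permutations being written as words $a_1a_2\cdots a_d$; a descent of such a permutation is an index $i\in\{1,\dots,d-1\}$ with $a_i>a_{i+1}$. The refined Eulerian number $\mathbf{A}_{d,k,j}$ is the number of permutations in $S_d$ with exactly $k$ descents and ending with the element $j$ (that is, $a_d=j$). Indexed permutations: for $n\geq1$, $S_d^n$ is the set of pairs $(a,z)$ where $a=a_1\cdots a_d\in S_d$ and $z=(z_1,\dots,z_d)\in\{0,1,\dots,n-1\}^d$ (each letter $a_i$ is assigned the index $z_i$). A descent of $(a,z)$ is an $i\in\{1,\dots,d\}$ such that $z_i>z_{i+1}$, or $z_i=z_{i+1}$ and $a_i>a_{i+1}$, with the convention $a_{d+1}=d+1$, $z_{d+1}=0$. $D(d,n,k)$ is the number of elements of $S_d^n$ with exactly $k$ descents. *)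

(* Defs.v *)
From mathcomp Require Import all_boot all_order all_fingroup all_algebra.

Set Implicit Arguments.
Unset Strict Implicit.
Unset Printing Implicit Defensive.

(* The word a_1 ... a_d of a permutation of {1, ..., d}: an element s of 'S_d
   permutes {0, ..., d-1}, so letters are shifted by one, and a_p is the item
   of 0-based position p - 1. *)
Definition word (d : nat) (s : 'S_d) : seq nat :=
  [seq (s i).+1 | i <- enum 'I_d].

Definition descents (d : nat) (s : 'S_d) : {set 'I_d.-1} :=
  [set i : 'I_d.-1 | nth 0 (word s) i.+1 < nth 0 (word s) i].

Definition refined_eulerian (d k j : nat) : nat :=
  #|[set s : 'S_d | (#|descents s| == k) && (last 0 (word s) == j)]|.

(* S_d^n as pairs (a, z). *)
Definition indexed_perm (d n : nat) : finType := ('S_d * d.-tuple 'I_n)%type.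

(* The default values of nth, reached only at position d, encode the
   conventions a_{d+1} = d + 1 and z_{d+1} = 0. *)
Definition iletter (d n : nat) (x : indexed_perm d n) (p : nat) : nat :=
  nth d.+1 (word x.1) p.

Definition iindex (d n : nat) (x : indexed_perm d n) (p : nat) : nat :=
  nth 0 [seq val t | t <- x.2] p.

Definition idescents (d n : nat) (x : indexed_perm d n) : {set 'I_d} :=
  [set i : 'I_d | (iindex x i.+1 < iindex x i)
     || (iindex x i == iindex x i.+1) && (iletter x i.+1 < iletter x i)].

Definition indexed_eulerian (d n k : nat) : nat :=
  #|[set x : indexed_perm d n | #|idescents x| == k]|.

(* Main.v *)
Require Import Defs.
From mathcomp Require Import all_boot all_order all_fingroup all_algebra.
From mathcomp Require Import ring zify.
Import Order.TTheory GRing.Theory Num.Theory.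
Local Open Scope ring_scope.

(** Part (i) is a recurrence.  Let [run_count n K c] count the permutations of
    {0, ..., n} with K ascending runs (one more than descents) and last letter
    c.  Deleting the last letter c of a permutation and standardizing the rest
    yields a permutation with last letter e, and exactly one run is lost if
    c <= e, none otherwise.  Passing from c to c + 1 therefore changes the
    outcome only when e = c, which gives
      run_count (n+1) (K+1) (c+1) - run_count (n+1) (K+1) c
        = run_count n (K+1) c - run_count n K c,
    and comparing the two extreme last letters gives
      run_count (n+1) (K+1) 0 = run_count (n+1) K (n+1).
    On the other side, [altsum m K h] is the coefficient of t^(K-1) in
    (1-t)^m sum_x h(x) t^x, and with h(x) = x^(n-c) (x+1)^c, m = n + 1 it
    satisfies the same two relations: the first is Pascal's rule together with
    (x+1) - x = 1, the second a shift of x by one.  Hence [run_countE].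

    Part (ii) reduces to part (i).  Group the indexed permutations (a, z) by the
    colouring w that sends each letter to its index, so z_p = w(a_p).  For fixed
    w, descents compare the pairs (index, letter) lexicographically, with a
    final pair (0, d+1) appended.  Replacing the d + 1 pairs by their ranks turns
    the words a into all the permutations of d + 1 letters whose last letter is
    the rank of (0, d+1), namely the number c of letters coloured 0
    ([standardization]).  Thus D(d,n,k) is the sum over w of the counts of
    part (i), and
      sum_w x^(d-c(w)) (x+1)^c(w) = ((x+1) + (n-1) x)^d = (n x + 1)^d
    because the summand is a product over the letters ([sum_run_poly]). *)

(** * Descents of words *)

Definition ndes (w : seq nat) : nat :=
  (\sum_(i < (size w).-1) (nth 0 w i.+1 < nth 0 w i))%N.

Lemma ndes_map (f : nat -> nat) (w : seq nat) :
  {mono f : x y / (x < y)%N} -> ndes (map f w) = ndes w.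
Proof.
move=> f_mono; rewrite /ndes size_map; apply: eq_bigr => i _.
have lt_i : (i.+1 < size w)%N by case: w i => [|x w] [].
by rewrite !(nth_map 0%N) ?f_mono // ltnW.
Qed.

Lemma ndes_rcons (w : seq nat) (c : nat) : (0 < size w)%N ->
  ndes (rcons w c) = (ndes w + (c < last 0 w))%N.
Proof.
move=> w_gt0; rewrite /ndes size_rcons /= -nth_last.
case Ew: (size w) w_gt0 => [//|m] _; rewrite big_ord_recr /=.
rewrite !nth_rcons Ew ltnn eqxx ltnSn; congr (_ + _)%N.
apply: eq_bigr => i _.
by rewrite !nth_rcons Ew !ltnS ltn_ord (ltnW (ltn_ord i)).
Qed.

Lemma size_word {d : nat} (s : 'S_d) : size (word s) = d.
Proof. by rewrite size_map size_enum_ord. Qed.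

Lemma nth_word {d : nat} (s : 'S_d) (i : 'I_d) (x0 : nat) :
  nth x0 (word s) i = (s i).+1.
Proof. by rewrite (nth_map i) ?size_enum_ord // nth_ord_enum. Qed.

Lemma last_word {n : nat} (s : 'S_n.+1) : last 0 (word s) = (s ord_max).+1.
Proof. by rewrite -nth_last size_word -(nth_word s ord_max 0). Qed.

Lemma card_descents {d : nat} (s : 'S_d) : #|descents s| = ndes (word s).
Proof. by rewrite cardsE -sum1_card /ndes size_word big_mkcond. Qed.

(** * Deleting the last letter *)

(** [lift_perm ord_max c s] is the permutation with last letter c whose other
    letters standardize to s. *)
Lemma word_lift_perm {n : nat} (c : 'I_n.+1) (s : 'S_n) :
  word (lift_perm ord_max c s) = rcons (map (bump c.+1) (word s)) c.+1.
Proof.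
apply: (@eq_from_nth _ 0%N); first by rewrite size_rcons size_map !size_word.
move=> p; rewrite size_word => lt_p.
rewrite -[p]/(nat_of_ord (Ordinal lt_p)) nth_word.
rewrite nth_rcons size_map size_word.
case: (unliftP ord_max (Ordinal lt_p)) => [q|] ->.
  rewrite lift_perm_lift lift_max ltn_ord (nth_map 0%N) ?size_word //.
  by rewrite nth_word /= /bump ltnS addnS.
by rewrite lift_perm_id /= ltnn eqxx.
Qed.

(** The last letter s_max of s becomes [bump c s_max], which exceeds c exactly
    when c <= s_max. *)
Lemma descents_lift_perm {n : nat} (c : 'I_n.+2) (s : 'S_n.+1) :
  #|descents (lift_perm ord_max c s)| = (#|descents s| + (c <= s ord_max))%N.
Proof.
have bump_mono h : {mono bump h : x y / (x < y)%N}.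
  by move=> x y; rewrite ltnNge leq_bump2 -ltnNge.
rewrite !card_descents word_lift_perm ndes_rcons; last first.
  by rewrite size_map size_word.
rewrite ndes_map //; congr (_ + nat_of_bool _)%N.
rewrite -nth_last size_map size_word (nth_map 0%N) ?size_word //.
rewrite -[n.+1.-1]/(nat_of_ord (@ord_max n)) nth_word /bump !ltnS.
have [le_c|lt_c] := leqP c (s ord_max); first by rewrite add1n !ltnS.
by rewrite add0n ltnS ltnNge ltnW.
Qed.

(** * Counting permutations by runs and last letter *)

(** Counting runs rather than descents makes the count vanish at [K = 0], so
    that the recurrence needs no boundary case for permutations without
    descents. *)
Definition run_count (n K c : nat) : nat :=
  #|[set s : 'S_n.+1 | (#|descents s|.+1 == K) && (s ord_max == c :> nat)]|.

Lemma refined_eulerianE (n k c : nat) :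
  refined_eulerian n.+1 k c.+1 = run_count n k.+1 c.
Proof. by apply: eq_card => s; rewrite !inE last_word !eqSS. Qed.

(** Permutations with prescribed last letter are exactly those obtained by
    inserting that letter at the end of a shorter permutation. *)
Lemma card_perm_last {n : nat} (c : 'I_n.+1) (P : pred 'S_n.+1) :
  #|[set t | P t && (t ord_max == c)]|
    = #|[set s : 'S_n | P (lift_perm ord_max c s)]|.
Proof.
have lp_inj : injective (@lift_perm n ord_max c).
  move=> s1 s2 e; apply/permP => i; apply: (@lift_inj _ c).
  by rewrite -!(lift_perm_lift ord_max) e.
rewrite -(card_imset _ lp_inj).
apply: eq_card => t; rewrite inE; apply/andP/imsetP.
  move=> [Pt /eqP tc].
  (* Only the last position is sent to c, so the default is never used. *)
  pose f k := odflt k (unlift c (t (lift ord_max k))).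
  have fE k : lift c (f k) = t (lift ord_max k).
    rewrite /f; case: unliftP => [j ->//|/=]; rewrite -tc => /perm_inj e.
    by have := neq_lift ord_max k; rewrite e eqxx.
  have f_inj : injective f.
    by move=> x y /(congr1 (lift c)); rewrite !fE => /perm_inj /lift_inj.
  have tE : t = lift_perm ord_max c (perm f_inj).
    apply/permP => x; case: (unliftP ord_max x) => [k|] ->.
      by rewrite lift_perm_lift permE fE.
    by rewrite lift_perm_id.
  by exists (perm f_inj) => //; rewrite inE -tE.
by case=> s; rewrite inE => Ps ->; rewrite lift_perm_id.
Qed.

(** Inserting the last letter c creates a new run exactly when it does not
    exceed the previous last letter. *)
Lemma run_countS (n K c : nat) : (c <= n.+1)%N ->
  run_count n.+1 K c =
    (\sum_(s : 'S_n.+1) (#|descents s|.+1 + (c <= s ord_max) == K))%N.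
Proof.
rewrite -ltnS => lt_c; pose c' := Ordinal lt_c.
rewrite /run_count (card_perm_last c' (fun t => #|descents t|.+1 == K)).
rewrite cardsE -sum1_card big_mkcond /=; apply: eq_bigr => s _.
by rewrite unfold_in /= descents_lift_perm addSn.
Qed.

Lemma run_count_sum (n K c : nat) : run_count n K c =
  (\sum_(s : 'S_n.+1) ((#|descents s|.+1 == K) && (s ord_max == c :> nat)))%N.
Proof.
by rewrite /run_count cardsE -sum1_card big_mkcond; apply: eq_bigr.
Qed.

(** Appending the smallest letter always creates a run, appending the largest
    one never does. *)
Lemma run_count_last_min (n K : nat) :
  run_count n.+1 K.+1 0 = run_count n.+1 K n.+1.
Proof.
rewrite !run_countS //; apply: eq_bigr => s _.
by rewrite (leqNgt n.+1) ltn_ord addn1 addn0 eqSS.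
Qed.

Lemma run_count0 (n c : nat) : run_count n 0 c = 0%N.
Proof. by rewrite run_count_sum big1. Qed.

(** Appending c or c + 1 to s has a different effect only if s ends with c:
    then c creates a new run while c + 1 does not. *)
Lemma run_count_diff (n K c : nat) : (c <= n)%N ->
  (run_count n.+1 K.+1 c.+1 + run_count n K c
     = run_count n.+1 K.+1 c + run_count n K.+1 c)%N.
Proof.
move=> le_c; rewrite run_countS // (@run_countS n K.+1 c (leqW le_c)).
rewrite !run_count_sum -!big_split /=.
apply: eq_bigr => s _; rewrite !addSn !eqSS.
case: (ltngtP c (s ord_max)) => _; rewrite ?andbF ?andbT ?addn0 ?addn1 //.
exact: addnC.
Qed.

Lemma run_count_base (K : nat) : run_count 0 K 0 = (K == 1%N).
Proof.
have no_desc (s : 'S_1) : #|descents s| = 0%N.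
  by apply/eqP; rewrite cards_eq0; apply/eqP/setP => [[]].
rewrite run_count_sum (bigD1 (1%g : 'S_1)) //= big1 => [|s].
  by rewrite no_desc perm1 addn0 andbT eq_sym.
by case/eqP; apply/permP => i; rewrite !ord1.
Qed.

(** * Alternating binomial sums *)

(** The coefficient of t^(K-1) in (1-t)^m sum_x h(x) t^x; it is 0 for
    [K = 0], like [run_count]. *)
Definition altsum (m K : nat) (h : nat -> int) : int :=
  \sum_(i < K) ('C(m, i))%:Z * (-1) ^+ i * h (K - i.+1)%N.

Lemma altsum0 (m : nat) (h : nat -> int) : altsum m 0 h = 0.
Proof. exact: big_ord0. Qed.

(** Multiplication of the generating series by 1 - t. *)
Lemma altsum_binS (m K : nat) (h : nat -> int) :
  altsum m.+1 K.+1 h = altsum m K.+1 h - altsum m K h.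
Proof.
rewrite /altsum !big_ord_recl /= !bin0 -addrA; congr (_ + _).
rewrite -sumrB; apply: eq_bigr => i _.
rewrite /bump /= !add1n binS PoszD !subSS exprS; ring.
Qed.

Lemma altsum_bin0 (K : nat) (h : nat -> int) : altsum 0 K.+1 h = h K.
Proof.
rewrite /altsum big_ord_recl big1 => [|i _]; last by rewrite bin_small ?mul0r.
by rewrite addr0 !mul1r subn1.
Qed.

Lemma altsum_shift (m K : nat) (h : nat -> int) :
  h 0%N = 0 -> altsum m K.+1 h = altsum m K (h \o succn).
Proof.
move=> h0; rewrite /altsum big_ord_recr /= subnn h0 mulr0 addr0.
by apply: eq_bigr => i _; rewrite subSn.
Qed.

Lemma eq_altsum (m K : nat) (h1 h2 : nat -> int) :
  h1 =1 h2 -> altsum m K h1 = altsum m K h2.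
Proof. by move=> eq_h; apply: eq_bigr => i _; rewrite eq_h. Qed.

Lemma altsumB (m K : nat) (h1 h2 : nat -> int) :
  altsum m K (fun x => h1 x - h2 x) = altsum m K h1 - altsum m K h2.
Proof. by rewrite -sumrB; apply: eq_bigr => i _; rewrite mulrBr. Qed.

Definition run_poly (n c x : nat) : int := x%:Z ^+ (n - c) * x.+1%:Z ^+ c.

(** The two products differ by the factors x + 1 and x, whose difference
    is 1. *)
Lemma run_poly_diff (n c x : nat) : (c <= n)%N ->
  run_poly n.+1 c.+1 x - run_poly n.+1 c x = run_poly n c x.
Proof.
move=> le_c; rewrite /run_poly subSS subSn // !exprS -addn1 PoszD; ring.
Qed.

(** Both sides satisfy the same recurrence: [run_count_diff] against
    [run_poly_diff] with Pascal's rule [altsum_binS], started by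
    [run_count_last_min] against [altsum_shift].  The innermost induction climbs
    from the last letter 0, whose count is the one of the largest last letter
    with one run fewer. *)
Lemma run_countE (n K c : nat) : (c <= n)%N ->
  (run_count n K c)%:Z = altsum n.+1 K (run_poly n c).
Proof.
elim: n K c => [|n IHn] K c.
  rewrite leqn0 => /eqP ->; rewrite run_count_base.
  case: K => [|K]; first by rewrite altsum0.
  rewrite altsum_binS altsum_bin0; case: K => [|K].
    by rewrite altsum0.
  by rewrite altsum_bin0 /run_poly.
elim: K c => [|K IHK] c; first by rewrite run_count0 altsum0.
elim: c => [_|c IHc le_c].
  rewrite run_count_last_min IHK // altsum_shift; last first.
    by rewrite /run_poly subn0 expr0n mul0r.
  by apply: eq_altsum => x; rewrite /run_poly /= subn0 subnn mul1r mulr1.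
have /(congr1 Posz) := run_count_diff n K c le_c; rewrite !PoszD.
rewrite !IHn ?(IHc (ltnW le_c)) // => /(canRL (addrK _)) ->.
rewrite -addrA -altsum_binS.
rewrite -(eq_altsum _ _ _ _ (fun x => run_poly_diff n c x le_c)).
by rewrite altsumB addrC subrK.
Qed.

(** * Standardization of coloured words *)

(** The rank of i is the number of smaller values of g. *)
Lemma ranking_perm {m : nat} (g : 'I_m -> nat) : injective g ->
  exists r : 'S_m, (forall i j, (r i < r j)%N = (g i < g j)%N)
    /\ forall i, r i = #|[set j | (g j < g i)%N]| :> nat.
Proof.
move=> g_inj; pose rk i := #|[set j | (g j < g i)%N]|.
have rk_lt i : (rk i < m)%N.
  rewrite -[X in (_ < X)%N](card_ord m) -cardsT; apply: proper_card.
  by apply/properP; split; [apply: subsetT | exists i; rewrite ?inE ?ltnn].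
have rk_homo i j : (g i < g j)%N -> (rk i < rk j)%N.
  move=> lt_ij; apply: proper_card; apply/properP; split.
    by apply/subsetP => l; rewrite !inE => /ltn_trans; apply.
  by exists i; rewrite inE ?ltnn.
have rk_mono i j : (rk i < rk j)%N = (g i < g j)%N.
  case: (ltngtP (g i) (g j)) => [/rk_homo //|/rk_homo/ltnW|/g_inj ->].
    by rewrite leqNgt => /negbTE.
  by rewrite ltnn.
have r_inj : injective (fun i => Ordinal (rk_lt i)).
  move=> i j /(congr1 val) e; have {}e : rk i = rk j := e.
  case: (ltngtP (g i) (g j)) => [| |/g_inj //].
    by rewrite -rk_mono e ltnn.
  by rewrite -rk_mono e ltnn.
by exists (perm r_inj); split=> *; rewrite !permE /=.
Qed.

(** Lexicographic comparison of pairs, read off from base-N notation. *)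
Lemma ltn_lex (N z z' a a' : nat) : (a < N)%N -> (a' < N)%N ->
  (z * N + a < z' * N + a')%N = (z < z')%N || (z == z') && (a < a')%N.
Proof.
move=> lt_a lt_a'; case: (ltngtP z z') => [lt_z|lt_z|->] /=.
- by apply/idP; nia.
- by apply/negbTE; rewrite -leqNgt; nia.
- by rewrite ltn_add2l.
Qed.

(** The indices follow the letters instead of the positions: w colours
    letters, and position p carries the colour of the letter s p. *)
Definition colored (d n : nat) (w : {ffun 'I_d -> 'I_n}) (s : 'S_d) :
  indexed_perm d n := (s, [tuple w (s p) | p < d]).

Lemma colored_bij (d n : nat) :
  bijective (fun u : {ffun 'I_d -> 'I_n} * 'S_d => colored d n u.1 u.2).
Proof.
exists (fun x : indexed_perm d n => ([ffun b => tnth x.2 (x.1^-1%g b)], x.1)).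
  move=> [w s]; congr (_, _); apply/ffunP => b.
  by rewrite ffunE tnth_mktuple permKV.
move=> [s z]; congr (_, _); apply: eq_from_tnth => p.
by rewrite tnth_mktuple ffunE permK.
Qed.

(** The permutation r ranks the coloured letters, with the conventional final
    letter included as the largest letter, of colour 0.  The letters below the
    final one are precisely the other letters of colour 0. *)
Lemma standardization (d n : nat) (w : {ffun 'I_d -> 'I_n}) :
  exists2 r : 'S_d.+1, r ord_max = #|[set b | w b == 0 :> nat]| :> nat
    & forall s, idescents (colored d n w s)
                = descents (lift_perm ord_max ord_max s * r)%g.
Proof.
pose z (a : 'I_d.+1) : nat := if unlift ord_max a is Some b then w b else 0%N.
(* The pair (z a, a) encoded as one number, in lexicographic order. *)
pose g (a : 'I_d.+1) : nat := (z a * d.+1 + a)%N.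
have g_inj : injective g.
  move=> a b /(congr1 (modn^~ d.+1)).
  by rewrite !modnMDl !modn_small //; apply: val_inj.
have [r [r_mono r_card]] := ranking_perm g g_inj.
exists r => [|s].
  rewrite r_card -[RHS](card_imset _ (@lift_inj _ ord_max)).
  apply: eq_card => a; rewrite inE ltn_lex // /z unlift_none ltn0 /=.
  case: (unliftP ord_max a) => [b|] ->.
    by rewrite lift_max ltn_ord andbT /= mem_imset ?inE //; apply: lift_inj.
  rewrite ltnn andbF; apply/esym/negbTE/negP => /imsetP [b _ /eqP].
  by rewrite (negbTE (neq_lift _ _)).
set L := lift_perm ord_max ord_max s; pose x := colored d n w s.
have letterE (q : 'I_d.+1) : iletter x q = (L q).+1.
  rewrite /iletter; case: (unliftP ord_max q) => [p|] ->.
    by rewrite lift_max nth_word /L lift_perm_lift lift_max.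
  by rewrite nth_default ?size_word // /L lift_perm_id.
have indexE (q : 'I_d.+1) : iindex x q = z (L q).
  rewrite /iindex /z; case: (unliftP ord_max q) => [p|] ->.
    rewrite lift_max /L lift_perm_lift liftK.
    by rewrite (nth_map (w (s p))) ?size_tuple // -tnth_nth tnth_mktuple.
  rewrite nth_default; last by rewrite size_map size_tuple.
  by rewrite /L lift_perm_id unlift_none.
apply/setP => i; rewrite !inE.
rewrite -[i.+1]/(nat_of_ord (lift ord0 i)).
move: (lift ord0 i) => q; rewrite -(lift_max i).
by rewrite !letterE !indexE !nth_word !permM !ltnS r_mono ltn_lex // eq_sym.
Qed.

(** As s varies, [lift_perm ord_max ord_max s * r] runs through all the
    permutations whose last letter is [r ord_max]. *)
Lemma card_colored (d n k : nat) (w : {ffun 'I_d -> 'I_n}) :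
  #|[set s | #|idescents (colored d n w s)| == k]|
    = run_count d k.+1 #|[set b | w b == 0 :> nat]|.
Proof.
have [r <- desE] := standardization d n w.
pose P (t : 'S_d.+1) := #|descents (t * r)%g| == k.
transitivity #|[set t | P t && (t ord_max == ord_max)]|.
  by rewrite card_perm_last; apply: eq_card => s; rewrite !inE desE.
rewrite /run_count -(card_imset _ (mulIg r)); apply: eq_card => t.
apply/imsetP/idP => [[u + ->]|].
  by rewrite !inE /P permM (inj_eq val_inj) (inj_eq perm_inj) eqSS.
rewrite inE eqSS (inj_eq val_inj) => /andP [Pt /eqP tr].
exists (t * r^-1)%g; last by rewrite mulgKV.
by rewrite inE /P mulgKV Pt permM tr permK eqxx.
Qed.

Lemma indexed_eulerianE (d n k : nat) : indexed_eulerian d n k =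
  (\sum_(w : {ffun 'I_d -> 'I_n})
     run_count d k.+1 #|[set b | w b == 0 :> nat]|)%N.
Proof.
rewrite /indexed_eulerian -sum1_card (reindex _ (onW_bij _ (colored_bij d n))).
under [RHS]eq_bigr => w _ do rewrite -card_colored -sum1_card.
by rewrite pair_big_dep /=; apply: eq_bigl => -[w s]; rewrite !inE.
Qed.

(** * Summation over the colourings *)

(** Written as a product over the letters, so that the sum over colourings
    distributes. *)
Lemma run_poly_prod (d n x : nat) (w : {ffun 'I_d -> 'I_n}) :
  run_poly d #|[set b | w b == 0 :> nat]| x =
    \prod_(b < d) (if w b == 0 :> nat then x.+1%:Z else x%:Z).
Proof.
have := cardC [pred b | w b == 0 :> nat].
rewrite card_ord /run_poly cardsE => /(canRL (addKn _)) <-.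
by rewrite big_if /= !prodr_const mulrC.
Qed.

Lemma sum_run_poly (d n x : nat) : (0 < n)%N ->
  \sum_(w : {ffun 'I_d -> 'I_n}) run_poly d #|[set b | w b == 0 :> nat]| x
    = (n%:Z * x%:Z + 1) ^+ d.
Proof.
move=> n_gt0; under eq_bigr => w _ do rewrite run_poly_prod.
rewrite -(bigA_distr_bigA (fun _ (z : 'I_n) =>
  if z == 0 :> nat then x.+1%:Z else x%:Z)) /= prodr_const card_ord.
congr (_ ^+ d); case: n n_gt0 => // n _.
rewrite big_ord_recl /= sumr_const card_ord -mulr_natl natz; lia.
Qed.

Lemma altsumE (m k : nat) (h : nat -> int) (f : int -> int) :
  (forall x : nat, h x = f x%:Z) ->
  altsum m k.+1 h =
    \sum_(i < k.+1) ('C(m, i))%:Z * (-1) ^+ i * f (k%:Z - i%:Z).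
Proof.
move=> hE; apply: eq_bigr => i _.
by rewrite hE subSS -subzn // -ltnS.
Qed.

Theorem corollary1p1 (d n k : nat) (hd : (1 <= d)%N) (hn : (1 <= n)%N) :
  (forall j : nat, (j <= d)%N ->
     (refined_eulerian d.+1 k (d - j + 1))%:Z =
       \sum_(i < k.+1) ('C(d.+1, i))%:Z * (-1) ^+ i
         * (k%:Z - i%:Z) ^+ j * (k%:Z - i%:Z + 1) ^+ (d - j)%N) /\
  (indexed_eulerian d n k)%:Z =
    \sum_(i < k.+1) ('C(d.+1, i))%:Z * (-1) ^+ i
      * (n%:Z * (k%:Z - i%:Z) + 1) ^+ d.
Proof.
split=> [j le_j|].
  rewrite addn1 refined_eulerianE run_countE ?leq_subr //.
  rewrite (altsumE _ _ _ (fun y => y ^+ j * (y + 1) ^+ (d - j))) => [|x].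
    by apply: eq_bigr => i _; rewrite mulrA.
  by rewrite /run_poly subKn // -addn1.
rewrite indexed_eulerianE (big_morph Posz PoszD (erefl _)).
transitivity (\sum_(w : {ffun 'I_d -> 'I_n})
    altsum d.+1 k.+1 (run_poly d #|[set b | w b == 0 :> nat]|)).
  apply: eq_bigr => w _; apply: run_countE.
  by rewrite -[X in (_ <= X)%N](card_ord d) max_card.
transitivity (altsum d.+1 k.+1 (fun x => (n%:Z * x%:Z + 1) ^+ d)).
  rewrite /altsum exchange_big /=.
  by apply: eq_bigr => i _; rewrite -mulr_sumr sum_run_poly.
exact: (altsumE _ _ _ (fun y => (n%:Z * y + 1) ^+ d)).
Qed.
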